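(* For every $n\in\mathbb{N}$, the maximum value of $P_n^{\text{park}}(\sigma)$ over $\sigma\in S_n$ is equal to $\frac{n!}{(n+1)^{n-1}}$ and is attained uniquely at $\sigma=1\cdots n$ (the identity permutation); moreover $\frac{n!}{(n+1)^{n-1}}\sim\frac{\sqrt{2\pi}\,n^{3/2}}{e^{n+1}}$ as $n\to\infty$. The minimum value of $P_n^{\text{park}}(\sigma)$ over $\sigma\in S_n$ is equal to $\frac1{(n+1)^{n-1}}$ and is attained uniquely at $\sigma=n\cdots1$ (the decreasing permutation).
   Context: $[n]=\{1,\dots,n\}$ and $S_n$ is the set of permutations $\sigma=\sigma_1\cdots\sigma_n$ of $[n]$. Parking: cars $1,\dots,n$ arrive in this order on a one-way street with spaces $1,\dots,n$; given a sequence $\pi=(\pi_1,\dots,\pi_n)\in[n]^n$ of preferred spaces, car $i$ parks in space $\pi_i$ if it is free, and otherwise in the first free space with number greater than $\pi_i$, if one exists (if none exists the car exits the street). $\pi$ is a parking function on $[n]$ if all $n$ cars are able to park; $\mathcal{P}_n$ is the set of parking functions on $[n]$. The map $T_n:\mathcal{P}_n\to S_n$ is $T_n(\pi)=\sigma$, where $\sigma_j$ is the number of the car that parked in space $j$, $j\in[n]$. The probability measure $P_n^{\text{park}}$ on $S_n$ is $P_n^{\text{park}}(\sigma)=|T_n^{-1}(\{\sigma\})|/|\mathcal{P}_n|$. $a_n\sim b_n$ means $a_n/b_n\to1$. *)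

(* Defs.v *)
(* MathComp / MathComp-Analysis.
   Cars and spaces 1, ..., n are the ordinals 0, ..., n-1 of 'I_n. *)
From HB Require Import structures.
From mathcomp Require Import all_boot all_order all_algebra all_fingroup.
From mathcomp Require Import all_classical all_reals all_analysis.

Set Implicit Arguments.
Unset Strict Implicit.
Unset Printing Implicit Defensive.

Import Order.TTheory GRing.Theory Num.Theory.
Import numFieldNormedType.Exports.

Local Open Scope ring_scope.

(* [st j] is the car parked in space [j], or [None] if that space is free. *)
Definition street (n : nat) : Type := {ffun 'I_n -> option 'I_n}.

Definition first_free_after (n : nat) (st : street n) (p : 'I_n) : option 'I_n :=
  ohead [seq j : 'I_n <- enum 'I_n | (p < j)%N && (st j == None)].

Definition parking_spot (n : nat) (st : street n) (p : 'I_n) : option 'I_n :=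
  if st p == None then Some p else first_free_after st p.

(* A car that finds no spot leaves the street unchanged. *)
Definition park_car (n : nat) (w : {ffun 'I_n -> 'I_n}) (st : street n)
    (i : 'I_n) : street n :=
  if parking_spot st (w i) is Some j
  then [ffun k => if k == j then Some i else st k]
  else st.

Definition final_street (n : nat) (w : {ffun 'I_n -> 'I_n}) : street n :=
  foldl (park_car w) [ffun => None] (enum 'I_n).

Definition all_cars_park (n : nat) (w : {ffun 'I_n -> 'I_n}) : bool :=
  [forall i : 'I_n, exists j : 'I_n, final_street w j == Some i].

Definition parking_function (n : nat) : Type :=
  {w : {ffun 'I_n -> 'I_n} | all_cars_park w}.

HB.instance Definition _ (n : nat) := Finite.on (parking_function n).

Lemma final_street_perm (n : nat) (w : parking_function n) :
  exists s : 'S_n, [forall j, final_street (val w) j == Some (s j)].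
Proof.
have place_ex i : exists j, final_street (val w) j == Some i.
  by have /forallP/(_ i)/existsP := valP w.
pose place i := xchoose (place_ex i).
have placeP i : final_street (val w) (place i) = Some i.
  exact/eqP/(xchooseP (place_ex i)).
have place_inj : injective place.
  by move=> i i' eq_ii'; apply: Some_inj; rewrite -!placeP eq_ii'.
exists (perm place_inj)^-1%g; apply/forallP => j; apply/eqP.
rewrite -[in LHS](permKV (perm place_inj) j) [in LHS]permE; exact: placeP.
Qed.

(* The unique permutation sending each space to the car parked there. *)
Definition Tpark (n : nat) (w : parking_function n) : 'S_n :=
  xchoose (final_street_perm w).

(* The probability mass function of the measure on 'S_n. *)
Definition Ppark (R : realType) (n : nat) (s : 'S_n) : R :=
  #|[set w : parking_function n | Tpark w == s]|%:R
    / #|{: parking_function n}|%:R.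

Definition decreasing_perm (n : nat) : 'S_n := perm (@rev_ord_inj n).

Definition asymptotically_equivalent (R : realType) (a b : nat -> R) : Prop :=
  ((fun n => a n / b n) @ \oo --> (1 : R))%classic.

(* Main.v *)
Require Import Defs.
From mathcomp Require Import all_boot all_order all_algebra all_fingroup.
From mathcomp Require Import all_classical all_reals all_analysis.
From mathcomp Require Import zify ring lra.

Set Implicit Arguments.
Unset Strict Implicit.
Unset Printing Implicit Defensive.

Import Order.TTheory GRing.Theory Num.Theory.
Import numFieldNormedType.Exports.

Local Open Scope ring_scope.

(** Three independent facts give the theorem.

    The number of parking functions with outcome [s] is a product.  Car [s j]
    ends in space [j] exactly when its preferred space [p] is at most [j] and
    every space from [p] up to [j] excluded is already taken, that is, holds a
    car that arrived before [s j].  These conditions constrain the preferences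
    of the different cars independently, so the fibre of [Tpark] over [s] has
    [\prod_j #|outcome_block s j|] elements ([card_outcome]).  Each block
    contains [j] and lies in the [j.+1] spaces up to [j]; hence the product is
    between [1] and [n`!].  It equals [n`!] only if all blocks are full, which
    forces [s] to have no inversion ([card_outcome_max]); it equals [1] only if
    all blocks are singletons, which forces [s] to have no ascent
    ([card_outcome_min]).

    The number of all parking functions is [n.+1 ^ n.-1]
    ([card_parking_function]).  This is Pollak's argument: close the street into
    a circle of [n.+1] spaces.  Then every car parks and one space stays free;
    rotating all preferences rotates that space, so each space is left free by
    the same number of the [n.+1 ^ n] preference lists.  Parking on the street
    succeeds exactly when the extra space stays free on the circle.

    The asymptotics is Stirling's formula.  The sequence
    [ln n! + n - (n + 1/2) ln n] is decreasing and bounded below, by two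
    elementary bounds on the logarithm, so it has a limit [l]; then
    [2 L_n - L_(2n)] also tends to [l], and the Wallis integrals evaluate this
    limit as [ln (2 pi) / 2].  The Wallis integrals are values of explicit
    primitives of the powers of the sine, so no integration is involved. *)

(** * Where a car parks *)

Lemma ohead_filterP (T : eqType) (r : rel T) (P : pred T) (s : seq T) :
  transitive r -> sorted r s ->
  match ohead [seq x <- s | P x] with
  | Some x => P x /\ {in s, forall y, P y -> y = x \/ r x y}
  | None => {in s, forall y, ~~ P y}
  end.
Proof.
move=> r_trans /(sorted_filter r_trans P).
have: forall y, (y \in [seq x <- s | P x]) = P y && (y \in s).
  by move=> y; rewrite mem_filter.
case: [seq x <- s | P x] => [|x t] /= mem_s.
  by move=> _ y s_y; have := mem_s y; rewrite s_y andbT => <-.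
move=> /(order_path_min r_trans)/allP min_x; split.
  by have := mem_s x; rewrite mem_head => /esym/andP[].
move=> y s_y Py; have: y \in x :: t by rewrite mem_s Py.
by rewrite inE => /orP[/eqP|/min_x]; [left | right].
Qed.

(** The street definition separates the preferred space from the later ones;
    here both cases become one: the first free space at or after [p]. *)
Lemma parking_spotP (n : nat) (st : street n) (p : 'I_n) :
  match parking_spot st p with
  | Some j => [/\ (p <= j)%N, st j = None
                & forall k : 'I_n, (p <= k < j)%N -> st k <> None]
  | None => forall k : 'I_n, (p <= k)%N -> st k <> None
  end.
Proof.
rewrite /parking_spot; case: eqP => [free_p|taken_p].
  by split=> // k; case: leqP.
have sorted_enum : sorted (fun i j : 'I_n => (i < j)%N) (enum 'I_n).
  by have := iota_ltn_sorted 0 n; rewrite -val_enum_ord sorted_map.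
have lt_trans : transitive (fun i j : 'I_n => (i < j)%N).
  by move=> j i k; apply: ltn_trans.
have := ohead_filterP (fun j : 'I_n => (p < j)%N && (st j == None))
                      lt_trans sorted_enum.
rewrite /first_free_after.
case: ohead => [j [/andP[lt_pj /eqP free_j] first_j]|none_free].
  split=> // [|k /andP[le_pk lt_kj] /eqP free_k]; first exact: ltnW.
  have [eq_pk|ne_pk] := eqVneq p k.
    by rewrite eq_pk (eqP free_k) in taken_p.
  have lt_pk : (p < k)%N by rewrite ltn_neqAle ne_pk.
  have [|eq_kj|lt_jk] := first_j k (mem_enum _ _); first by rewrite lt_pk.
    by rewrite eq_kj ltnn in lt_kj.
  by have := ltn_trans lt_kj lt_jk; rewrite ltnn.
move=> k le_pk free_k.
have [eq_pk|ne_pk] := eqVneq p k; first by rewrite eq_pk in taken_p.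
by have := none_free k (mem_enum _ _); rewrite free_k ltn_neqAle ne_pk le_pk.
Qed.

Lemma parking_spot_eq (n : nat) (st : street n) (p j : 'I_n) :
  (p <= j)%N -> st j = None -> (forall k : 'I_n, (p <= k < j)%N -> st k <> None) ->
  parking_spot st p = Some j.
Proof.
move=> le_pj free_j taken; have := parking_spotP st p.
case: parking_spot => [i [le_pi free_i taken_i]|/(_ j le_pj)//].
have [lt_ij|lt_ji|eq_ij] := ltngtP i j; last by congr Some; apply: val_inj.
  by case: (taken i) => //; rewrite le_pi.
by case: (taken_i j) => //; rewrite le_pj.
Qed.

(** The street for an arbitrary arrival order [s], so that the state before a
    given car arrives can be named. *)
Definition street_after (n : nat) (w : {ffun 'I_n -> 'I_n}) (s : seq 'I_n) :
  street n := foldl (park_car w) [ffun => None] s.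

Section StreetAfter.
Variables (n : nat) (w : {ffun 'I_n -> 'I_n}).
Implicit Types (s : seq 'I_n) (i j : 'I_n).

Lemma street_after_rcons s i :
  street_after w (rcons s i) = park_car w (street_after w s) i.
Proof. by rewrite /street_after foldl_rcons. Qed.

Lemma street_after_mem s i j : street_after w s j = Some i -> i \in s.
Proof.
elim/last_ind: s => [|s k IHs]; first by rewrite /street_after /= ffunE.
rewrite street_after_rcons mem_rcons inE /park_car.
case: parking_spot => [l|/IHs ->]; last by rewrite orbT.
rewrite ffunE; case: eqP => [_ [->]|_ /IHs ->]; first by rewrite eqxx.
by rewrite orbT.
Qed.

Lemma street_after_keep s s' i j :
  street_after w s j = Some i -> street_after w (s ++ s') j = Some i.
Proof.
move=> s_j; elim/last_ind: s' => [|s' k IHs]; first by rewrite cats0.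
rewrite -rcons_cat street_after_rcons /park_car.
have := parking_spotP (street_after w (s ++ s')) (w k).
case: parking_spot => [l [_ free_l _]|_]; last exact: IHs.
by rewrite ffunE; case: eqP => // eq_jl; rewrite -eq_jl IHs in free_l.
Qed.

Lemma street_after_rcons_spot s i j :
  street_after w (rcons s i) j = Some i -> i \notin s ->
  parking_spot (street_after w s) (w i) = Some j.
Proof.
rewrite street_after_rcons /park_car => + s'i.
case: parking_spot => [l|/street_after_mem s_i]; last by rewrite s_i in s'i.
rewrite ffunE; case: eqP => [-> //|_ /street_after_mem s_i].
by rewrite s_i in s'i.
Qed.

End StreetAfter.

(** * The number of parking functions with a given outcome *)

(** The preferences with which car [s j], arriving after exactly the cars with
    smaller numbers, can end in space [j]. *)
Definition outcome_block (n : nat) (s : 'S_n) (j : 'I_n) : {set 'I_n} :=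
  [set p : 'I_n | (p <= j)%N && [forall k : 'I_n, (p <= k < j)%N ==> (s k < s j)%N]].

Lemma outcome_blockP (n : nat) (s : 'S_n) (j p : 'I_n) :
  reflect ((p <= j)%N /\ forall k : 'I_n, (p <= k < j)%N -> (s k < s j)%N)
          (p \in outcome_block s j).
Proof.
rewrite inE; apply: (iffP andP) => -[le_pj].
  by move=> /forallP lt_s; split=> // k pkj; have := lt_s k; rewrite pkj.
by move=> lt_s; split=> //; apply/forallP => k; apply/implyP/lt_s.
Qed.

Lemma enum_ord_split (n : nat) (i : 'I_n) :
  enum 'I_n = rcons (take i (enum 'I_n)) i ++ drop i.+1 (enum 'I_n).
Proof.
rewrite -[in LHS](cat_take_drop i.+1 (enum 'I_n)); congr (_ ++ _).
by rewrite (take_nth i) ?size_enum_ord// nth_ord_enum.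
Qed.

Lemma mem_take_enum_ord (n : nat) (t : nat) (i : 'I_n) :
  (i \in take t (enum 'I_n)) = (i < t)%N.
Proof.
rewrite -(mem_map val_inj) map_take val_enum_ord take_iota mem_iota add0n /=.
by have := ltn_ord i; lia.
Qed.

(** If the outcome is [s], then just before car [s j] arrives only cars with
    smaller numbers are parked, each in its final space, and car [s j] passed
    over taken spaces only.  Conversely, if all preferences lie in their blocks,
    the street before car [t] arrives is [s] restricted to the values below [t],
    by induction on [t]. *)
Lemma final_street_outcome (n : nat) (w : {ffun 'I_n -> 'I_n}) (s : 'S_n) :
  (forall j, final_street w j = Some (s j)) <->
  (forall j, w (s j) \in outcome_block s j).
Proof.
split=> [final_s j|pref_s].
  have final_split : final_street w =
      street_after w (rcons (take (s j) (enum 'I_n)) (s j) ++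
                      drop (s j).+1 (enum 'I_n)).
    by rewrite /final_street -enum_ord_split.
  set s0 := take (s j) (enum 'I_n) in final_split.
  have notin_s0 : s j \notin s0 by rewrite mem_take_enum_ord ltnn.
  have early k i : street_after w s0 k = Some i -> i = s k.
    move=> /(street_after_keep ([:: s j] ++ drop (s j).+1 (enum 'I_n))).
    by rewrite catA cats1 -final_split final_s => -[].
  have spot_j : parking_spot (street_after w s0) (w (s j)) = Some j.
    have := parking_spotP (street_after w s0) (w (s j)).
    case E: parking_spot => [l|].
      move=> _; congr Some; apply: (@perm_inj _ s).
      have: street_after w (rcons s0 (s j)) l = Some (s j).
        by rewrite street_after_rcons /park_car E ffunE eqxx.
      move=> /(street_after_keep (drop (s j).+1 (enum 'I_n))).
      by rewrite -final_split final_s => -[].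
    (* Otherwise skipping car [s j] changes nothing, although it occurs on the
       final street. *)
    move=> _.
    have: street_after w (s0 ++ drop (s j).+1 (enum 'I_n)) j = Some (s j).
      move: (final_s j); rewrite final_split /street_after !foldl_cat foldl_rcons.
      by rewrite -/(street_after w s0) /park_car E.
    move=> /street_after_mem; rewrite mem_cat (negPf notin_s0) /=.
    move=> drop_sj; have := enum_uniq 'I_n; rewrite (enum_ord_split (s j)).
    rewrite cat_uniq => /and3P[_ /hasPn/(_ _ drop_sj)].
    by rewrite mem_rcons mem_head.
  have := parking_spotP (street_after w s0) (w (s j)).
  rewrite spot_j => -[le_j _ taken]; apply/outcome_blockP; split=> // k /taken.
  case E: (street_after w s0 k) => [i|] // _.
  by have := street_after_mem E; rewrite (early _ _ E) mem_take_enum_ord.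
have street_t t : (t <= n)%N -> forall j,
    street_after w (take t (enum 'I_n)) j =
    if (s j < t)%N then Some (s j) else None.
  elim: t => [_ j|t IHt lt_tn j]; first by rewrite take0 /street_after /= ffunE.
  pose i := Ordinal lt_tn; pose l := (s^-1)%g i.
  have s_l : s l = i by rewrite permKV.
  rewrite (take_nth i) ?size_enum_ord// (nth_ord_enum i i) street_after_rcons.
  have lt_n := ltnW lt_tn.
  have /outcome_blockP[le_l taken] := pref_s l; rewrite s_l in le_l taken.
  rewrite /park_car (@parking_spot_eq _ _ _ l) // ?IHt// ?s_l /= ?ltnn//; last first.
    by move=> k /taken /= lt_k; rewrite IHt// lt_k.
  rewrite ffunE; case: eqP => [->|ne_jl]; first by rewrite s_l /= ltnSn.
  rewrite IHt// ltnS [in RHS]leq_eqVlt.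
  have /negPf-> // : val (s j) != t.
  apply/eqP => s_j; apply: ne_jl; apply: (@perm_inj _ s); apply: val_inj.
  by rewrite s_l.
move=> j; rewrite /final_street -(take_size (enum 'I_n)) size_enum_ord.
by have := street_t n (leqnn n) j; rewrite ltn_ord.
Qed.

Lemma TparkP (n : nat) (w : parking_function n) (s : 'S_n) :
  reflect (forall j, final_street (val w) j = Some (s j)) (Tpark w == s).
Proof.
have /forallP spec := xchooseP (final_street_perm w); rewrite -/(Tpark w) in spec.
apply: (iffP eqP) => [<- j|final_s]; first exact/eqP.
by apply/permP => j; apply: Some_inj; rewrite -final_s (eqP (spec j)).
Qed.

(** By [final_street_outcome] the fibre is a product of blocks, one for each
    car. *)
Lemma card_outcome (n : nat) (s : 'S_n) :
  #|[set w : parking_function n | Tpark w == s]| =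
  (\prod_(j < n) #|outcome_block s j|)%N.
Proof.
pose F i := outcome_block s ((s^-1)%g i).
have familyE w : reflect (forall j, final_street w j = Some (s j)) (w \in family F).
  apply: (iffP familyP) => [w_F|/final_street_outcome w_s i].
    apply/final_street_outcome => j.
    by have := w_F (s j); rewrite /F permK.
  by have := w_s ((s^-1)%g i); rewrite permKV.
rewrite -(card_imset _ val_inj).
have -> : val @: [set w : parking_function n | Tpark w == s] = [set w in family F].
  apply/setP => w; rewrite inE; apply/imsetP/familyE.
    by case=> v + ->; rewrite inE => /TparkP.
  move=> final_s; have all_park : all_cars_park w.
    apply/forallP => i; apply/existsP; exists ((s^-1)%g i).
    by rewrite final_s permKV.
  by exists (Sub w all_park); rewrite ?SubK// inE; apply/TparkP.
rewrite cardsE card_family foldrE big_map big_enum /=.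
by rewrite [RHS](reindex_inj (@perm_inj _ (s^-1)%g)).
Qed.

(** * Extremal outcomes *)

Lemma card_ord_le (n : nat) (j : 'I_n) : #|[set p : 'I_n | (p <= j)%N]| = j.+1.
Proof.
rewrite cardsE -sum1_card -(big_ord_widen n (fun=> 1)%N (ltn_ord j)).
by rewrite sum1_card card_ord.
Qed.

Lemma outcome_block_sub (n : nat) (s : 'S_n) (j : 'I_n) :
  outcome_block s j \subset [set p : 'I_n | (p <= j)%N].
Proof. by apply/fintype.subsetP => p /outcome_blockP[? _]; rewrite inE. Qed.

Lemma mem_outcome_block (n : nat) (s : 'S_n) (j : 'I_n) : j \in outcome_block s j.
Proof. by apply/outcome_blockP; split=> // k; case: leqP. Qed.

Lemma leq_card_outcome_block (n : nat) (s : 'S_n) (j : 'I_n) :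
  (0 < #|outcome_block s j| <= j.+1)%N.
Proof.
rewrite -card_ord_le subset_leq_card ?outcome_block_sub// andbT.
by apply/card_gt0P; exists j; exact: mem_outcome_block.
Qed.

Lemma inversion_card_outcome_block (n : nat) (s : 'S_n) (k j : 'I_n) :
  (k < j)%N -> (s j < s k)%N -> (#|outcome_block s j| < j.+1)%N.
Proof.
move=> lt_kj lt_s; rewrite -card_ord_le; apply: proper_card.
rewrite properE outcome_block_sub; apply/fintype.subsetPn; exists k.
  by rewrite inE ltnW.
apply/outcome_blockP => -[_ /(_ k)]; rewrite leqnn lt_kj => /(_ isT).
by rewrite ltnNge ltnW.
Qed.

Lemma ascent_card_outcome_block (n : nat) (s : 'S_n) (k j : 'I_n) :
  k.+1 = j -> (s k < s j)%N -> (1 < #|outcome_block s j|)%N.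
Proof.
move=> eq_j lt_s; apply/card_gt1P; exists k, j; split.
- apply/outcome_blockP; split=> [|i]; first by rewrite -eq_j.
  rewrite -eq_j ltnS -eqn_leq => /eqP eq_ki.
  by rewrite -(val_inj eq_ki).
- exact: mem_outcome_block.
by apply/eqP => eq_kj; rewrite eq_kj ltnn in lt_s.
Qed.

Lemma ltn_prod_ord (n : nat) (F G : 'I_n -> nat) (i : 'I_n) :
  (forall j, (0 < F j <= G j)%N) -> (F i < G i)%N ->
  (\prod_(j < n) F j < \prod_(j < n) G j)%N.
Proof.
move=> leFG ltFGi; rewrite (bigD1 i) // [ltnRHS](bigD1 i) //=.
apply: (@leq_trans (G i * \prod_(j < n | j != i) F j)); last first.
  by rewrite leq_mul2l leq_prod ?orbT// => j _; have /andP[] := leFG j.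
rewrite ltn_mul2r ltFGi andbT prodn_cond_gt0// => j _.
by have /andP[] := leFG j.
Qed.

Lemma prod_succ_ord (n : nat) : (\prod_(j < n) j.+1 = n`!)%N.
Proof. by rewrite fact_prod big_add1 big_mkord. Qed.

Lemma card_outcome_bounds (n : nat) (s : 'S_n) :
  (0 < #|[set w : parking_function n | Tpark w == s]| <= n`!)%N.
Proof.
rewrite card_outcome -prod_succ_ord prodn_gt0 ?leq_prod// => j *;
by have /andP[] := leq_card_outcome_block s j.
Qed.

(** By induction on [j], [s] fixes everything below [j]; so [s j] is not below
    [j], and if it were above [j], the preimage of [j] would be above [j] too
    and give an inversion. *)
Lemma increasing_perm_id (n : nat) (s : 'S_n) :
  (forall k j : 'I_n, (k < j)%N -> (s k < s j)%N) -> s = 1%g.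
Proof.
move=> s_inc; apply/permP => j; rewrite perm1; apply: val_inj.
have [m] := ubnP (val j); elim: m j => // m IHm j lt_jm.
have [lt_sj|lt_js|//] := ltngtP (s j) j.
  have := IHm _ (leq_trans lt_sj lt_jm).
  by move/val_inj/perm_inj => /(congr1 val) /= E; rewrite E ltnn in lt_sj.
pose k := (s^-1)%g j; have s_k : s k = j by rewrite permKV.
have [lt_kj|lt_jk|eq_kj] := ltngtP k j.
- have := IHm k (leq_trans lt_kj lt_jm); rewrite s_k => E.
  by rewrite E ltnn in lt_kj.
- by have := s_inc _ _ lt_jk; rewrite s_k => /(ltn_trans lt_js); rewrite ltnn.
by rewrite -[X in (_ < s X)%N](val_inj eq_kj) s_k ltnn in lt_js.
Qed.

(** An inversion [k < j], [s j < s k] removes [k] from the block of [j], so one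
    factor drops below its bound. *)
Lemma card_outcome_max (n : nat) (s : 'S_n) :
  #|[set w : parking_function n | Tpark w == s]| = n`! -> s = 1%g.
Proof.
move=> max_s; apply: increasing_perm_id => k j lt_kj; rewrite ltnNge.
apply/negP => le_s; move/eqP: max_s; apply/negP; rewrite neq_ltn; apply/orP; left.
have lt_s : (s j < s k)%N.
  rewrite ltn_neqAle le_s andbT; apply/eqP => /val_inj/perm_inj eq_jk.
  by rewrite eq_jk ltnn in lt_kj.
rewrite card_outcome -prod_succ_ord (@ltn_prod_ord _ _ _ j) //.
  exact: leq_card_outcome_block.
exact: inversion_card_outcome_block lt_s.
Qed.

Lemma card_outcome_id (n : nat) :
  #|[set w : parking_function n | Tpark w == 1%g]| = n`!.
Proof.
rewrite card_outcome -prod_succ_ord; apply: eq_bigr => j _.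
rewrite -[RHS]card_ord_le; apply: eq_card => p; rewrite [in RHS]inE.
apply/outcome_blockP/idP => [[]//|le_pj]; split=> // k.
by rewrite !perm1 => /andP[].
Qed.

Lemma decreasing_perm_uniq (n : nat) (s : 'S_n) :
  (forall k j : 'I_n, (k < j)%N -> (s j < s k)%N) -> s = decreasing_perm n.
Proof.
move=> s_dec; have invol : (decreasing_perm n * decreasing_perm n = 1)%g.
  by apply/permP => i; rewrite permM !permE rev_ordK.
rewrite -[s]mulg1 -invol mulgA (_ : (s * _ = 1)%g) ?mul1g//.
apply: increasing_perm_id => k j /s_dec.
by rewrite !permM !permE /=; have := ltn_ord (s k); lia.
Qed.

(** An ascent between adjacent spaces puts both of them in the block of the
    second, so one factor exceeds [1]; a permutation whose adjacent values all
    descend is decreasing. *)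
Lemma card_outcome_min (n : nat) (s : 'S_n) :
  #|[set w : parking_function n | Tpark w == s]| = 1 -> s = decreasing_perm n.
Proof.
move=> min_s; have desc (k j : 'I_n) : k.+1 = j -> (s j < s k)%N.
  move=> eq_j; rewrite ltnNge; apply/negP => le_s.
  have lt_s : (s k < s j)%N.
    rewrite ltn_neqAle le_s andbT; apply/eqP => /val_inj/perm_inj eq_jk.
    by move: (congr1 val eq_jk) => /=; lia.
  move/eqP: min_s; apply/negP; rewrite neq_ltn; apply/orP; right.
  have := @ltn_prod_ord n (fun=> 1%N) (fun i => #|outcome_block s i|) j.
  rewrite big1 // -card_outcome; apply.
    by move=> i; have /andP[] := leq_card_outcome_block s i.
  exact: ascent_card_outcome_block lt_s.
apply: decreasing_perm_uniq => k j; have [m] := ubnP (nat_of_ord j).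
elim: m j => // m IHm j lt_jm lt_kj.
have lt_pn : (j.-1 < n)%N by have := ltn_ord j; lia.
have lt_p : (s j < s (Ordinal lt_pn))%N.
  by apply: desc; rewrite /= prednK// (leq_ltn_trans _ lt_kj).
have [eq_kp|ne_kp] := eqVneq k (Ordinal lt_pn); first by rewrite eq_kp.
apply: ltn_trans lt_p _; apply: IHm => /=; first by lia.
have : nat_of_ord k <> j.-1.
  by move=> eq_k; move/eqP: ne_kp; apply; apply: val_inj.
by lia.
Qed.

Lemma card_outcome_decreasing (n : nat) :
  #|[set w : parking_function n | Tpark w == decreasing_perm n]| = 1.
Proof.
rewrite card_outcome big1// => j _; apply/eqP/cards1P; exists j.
apply/setP => p; rewrite inE; apply/idP/eqP => [|->]; last exact: mem_outcome_block.
move=> /outcome_blockP[le_pj /(_ p)]; rewrite leqnn /= !permE /=.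
have [lt_pj /(_ isT)|lt_jp|eq_pj _] := ltngtP p j; last exact: val_inj.
  by have := ltn_ord j; lia.
by rewrite leqNgt lt_jp in le_pj.
Qed.

(** * Pollak's circular street *)

(** On the circle the spaces are the integers modulo [n.+1], so the addition
    wraps around. *)
Definition circular_spot (n : nat) (A : {set 'I_n.+1}) (p : 'I_n.+1) : 'I_n.+1 :=
  p + inZp (find (fun d => p + inZp d \notin A) (iota 0 n.+1)).

Definition circular_taken (n : nat) (w : {ffun 'I_n -> 'I_n.+1}) (s : seq 'I_n) :
  {set 'I_n.+1} := foldl (fun A i => circular_spot A (w i) |: A) finset.set0 s.

Lemma circular_taken_rcons (n : nat) (w : {ffun 'I_n -> 'I_n.+1}) s i :
  circular_taken w (rcons s i) =
  circular_spot (circular_taken w s) (w i) |: circular_taken w s.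
Proof. by rewrite /circular_taken foldl_rcons. Qed.

(** Any free space [q] shows that the search succeeds, since [q] is reached from
    [p] after [q - p] steps. *)
Lemma circular_spot_free (n : nat) (A : {set 'I_n.+1}) (p q : 'I_n.+1) :
  q \notin A -> circular_spot A p \notin A.
Proof.
move=> A'q; pose P d := p + inZp d \notin A.
have hasP : has P (iota 0 n.+1).
  apply/hasP; exists (nat_of_ord (q - p)%R).
    by rewrite mem_iota leq0n add0n; exact: ltn_ord.
  by rewrite /P valZpK addrC subrK.
have := nth_find 0%N hasP; rewrite nth_iota ?add0n//.
by move: hasP; rewrite has_find size_iota.
Qed.

Lemma circular_spot_eq (n : nat) (A : {set 'I_n.+1}) (p : 'I_n.+1) (d : nat) :
  (d < n.+1)%N -> p + inZp d \notin A ->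
  (forall k, (k < d)%N -> p + inZp k \in A) -> circular_spot A p = p + inZp d.
Proof.
move=> lt_dn A'd A_lt; rewrite /circular_spot; congr (_ + inZp _).
pose P d := p + inZp d \notin A; rewrite -/P.
have hasP : has P (iota 0 n.+1).
  by apply/hasP; exists d => //; rewrite mem_iota add0n.
have lt_f : (find P (iota 0 n.+1) < n.+1)%N.
  by rewrite has_find size_iota in hasP.
have [lt_fd|lt_df|//] := ltngtP (find P (iota 0 n.+1)) d.
  by have := nth_find 0%N hasP; rewrite nth_iota// add0n /P A_lt.
by have := before_find 0%N lt_df; rewrite nth_iota// add0n /P A'd.
Qed.

Lemma card_circular_taken (n : nat) (w : {ffun 'I_n -> 'I_n.+1}) s :
  (size s <= n.+1)%N -> #|circular_taken w s| = size s.
Proof.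
elim/last_ind: s => [|s i IHs]; first by rewrite cards0.
rewrite size_rcons => lt_s; rewrite circular_taken_rcons cardsU1.
rewrite IHs ?(ltnW lt_s)//.
have /card_gt0P[q] : (0 < #|~: circular_taken w s|)%N.
  by rewrite cardsCs finset.setCK card_ord IHs ?(ltnW lt_s)// subn_gt0.
by rewrite inE => /circular_spot_free->.
Qed.

Lemma pref_circular_taken (n : nat) (w : {ffun 'I_n -> 'I_n.+1}) s i :
  i \in s -> w i \in circular_taken w s.
Proof.
elim/last_ind: s => // s k IHs; rewrite mem_rcons inE circular_taken_rcons inE.
case/predU1P=> [->|/IHs ->]; last by rewrite orbT.
have [//|free_k] := boolP (w k \in circular_taken w s); first by rewrite orbT.
rewrite orbF inE (@circular_spot_eq _ _ _ 0%N) //.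
  by rewrite (_ : inZp 0 = 0) ?addr0 //; apply: val_inj; rewrite /= mod0n.
by rewrite (_ : inZp 0 = 0) ?addr0 //; apply: val_inj; rewrite /= mod0n.
Qed.

Definition rotate_pref (n : nat) (c : 'I_n.+1) (w : {ffun 'I_n -> 'I_n.+1}) :
  {ffun 'I_n -> 'I_n.+1} := [ffun i => w i + c].

(** The search for a free space only uses differences of spaces, so the circular
    process commutes with rotations. *)
Lemma mem_circular_taken_rotate (n : nat) (c : 'I_n.+1) w s (a : 'I_n.+1) :
  (a + c \in circular_taken (rotate_pref c w) s) = (a \in circular_taken w s).
Proof.
elim/last_ind: s a => [a|s i IHs a]; first by rewrite !inE.
rewrite !circular_taken_rcons !inE IHs; congr (_ || _).
suff -> : circular_spot (circular_taken (rotate_pref c w) s) (rotate_pref c w i)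
        = circular_spot (circular_taken w s) (w i) + c.
  by rewrite (inj_eq (addIr c)).
rewrite /circular_spot ffunE.
rewrite (eq_find (_ : _ =1 (fun d => w i + inZp d \notin circular_taken w s))).
  by rewrite addrAC.
by move=> d; rewrite addrAC IHs.
Qed.

Definition leaves_free (n : nat) (c : 'I_n.+1) : {set {ffun 'I_n -> 'I_n.+1}} :=
  [set w | c \notin circular_taken w (enum 'I_n)].

Lemma card_leaves_free_eq (n : nat) (c : 'I_n.+1) :
  #|leaves_free c| = #|leaves_free (0 : 'I_n.+1)|.
Proof.
have rot_inj : injective (@rotate_pref n c).
  move=> v w /ffunP eq_vw; apply/ffunP => i.
  by have := eq_vw i; rewrite !ffunE => /addIr.
rewrite -[RHS](card_imset _ rot_inj); apply: eq_card => w.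
apply/idP/imsetP => [free_w|[v free_v ->]].
  exists (rotate_pref (- c) w).
    by move: free_w; rewrite !inE -(mem_circular_taken_rotate (- c)) subrr.
  by apply/ffunP => i; rewrite !ffunE subrK.
by move: free_v; rewrite !inE -(mem_circular_taken_rotate c) add0r.
Qed.

(** The [n] cars take [n] of the [n.+1] spaces, so each of the [n.+1 ^ n]
    preference lists leaves exactly one space free, and by rotation all spaces
    are left free equally often. *)
Lemma card_leaves_free (n : nat) (c : 'I_n.+1) :
  (0 < n)%N -> #|leaves_free c| = (n.+1 ^ n.-1)%N.
Proof.
move=> n_gt0; apply/eqP; rewrite -(eqn_pmul2l (ltn0Sn n)) -expnS prednK//.
have -> : (n.+1 ^ n)%N = (\sum_(w : {ffun 'I_n -> 'I_n.+1}) 1)%N.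
  by rewrite sum1_card card_ffun !card_ord.
have -> : (n.+1 * #|leaves_free c| = \sum_(a : 'I_n.+1) #|leaves_free a|)%N.
  rewrite (eq_bigr (fun=> #|leaves_free c|)).
    by rewrite sum_nat_const card_ord.
  by move=> a _; rewrite [LHS]card_leaves_free_eq card_leaves_free_eq.
under eq_bigr do rewrite -sum1_card.
under [eqbLHS]eq_bigr do under eq_bigl do rewrite inE.
rewrite (exchange_big_dep xpredT) //=; apply/eqP/eq_bigr => w _.
rewrite sum1_card -[X in _ = X](_ : #|~: circular_taken w (enum 'I_n)| = _).
  by apply: eq_card => a; rewrite !inE.
by rewrite cardsCs finset.setCK card_ord card_circular_taken size_enum_ord// subSnn.
Qed.

Section LinearCircular.
Variable n : nat.
Implicit Types (w : {ffun 'I_n -> 'I_n}) (s : seq 'I_n) (st : street n).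

Definition widen_space (p : 'I_n) : 'I_n.+1 := widen_ord (leqnSn n) p.

Lemma widen_space_inj : injective widen_space.
Proof. by move=> p q /(congr1 val) /= /val_inj. Qed.

Lemma widen_space_neq_max p : widen_space p != ord_max.
Proof. by apply/eqP => /(congr1 val) /= E; have := ltn_ord p; rewrite E ltnn. Qed.

Definition taken_spaces st : {set 'I_n.+1} :=
  widen_space @: [set j | st j != None].

Lemma mem_taken_spaces st j : (widen_space j \in taken_spaces st) = (st j != None).
Proof. by rewrite (mem_imset _ _ widen_space_inj) inE. Qed.

Lemma max_notin_taken_spaces st : ord_max \notin taken_spaces st.
Proof.
by apply/imsetP => -[p _ /esym/eqP]; rewrite (negPf (widen_space_neq_max p)).
Qed.

(** While the extra space [ord_max] is free, a car on the circle never wraps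
    around: it parks as on the street, or takes [ord_max] if the street has no
    space for it. *)
Lemma circular_spot_linear st p :
  circular_spot (taken_spaces st) (widen_space p) =
  if parking_spot st p is Some j then widen_space j else ord_max.
Proof.
have step k : (p + k <= n)%N -> val (widen_space p + inZp k)%R = (p + k)%N.
  by move=> le_n; rewrite /= modnDmr modn_small.
have taken_step k (lt_n : (p + k < n)%N) :
    st (Ordinal lt_n) <> None -> widen_space p + inZp k \in taken_spaces st.
  move=> taken; rewrite (_ : _ + _ = widen_space (Ordinal lt_n)).
    by rewrite mem_taken_spaces; apply/eqP.
  by apply: val_inj; rewrite step // ltnW.
have := parking_spotP st p; case: parking_spot => [j [le_pj free_j taken]|taken].
  have eq_j : widen_space p + inZp (j - p) = widen_space j.
    by apply: val_inj; rewrite step ?subnKC//= ltnW.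
  rewrite (@circular_spot_eq _ _ _ (j - p)) ?eq_j//.
  - by have := ltn_ord j; lia.
  - by rewrite mem_taken_spaces free_j.
  move=> k lt_k; have lt_n : (p + k < n)%N by have := ltn_ord j; lia.
  by apply: taken_step; apply: taken => /=; lia.
have eq_max : widen_space p + inZp (n - p) = ord_max.
  by apply: val_inj; rewrite step subnKC// ltnW.
rewrite (@circular_spot_eq _ _ _ (n - p)) ?eq_max//.
- by lia.
- exact: max_notin_taken_spaces.
move=> k lt_k; have lt_n : (p + k < n)%N by lia.
by apply: taken_step; apply: taken => /=; lia.
Qed.

Definition widen_pref w : {ffun 'I_n -> 'I_n.+1} := [ffun i => widen_space (w i)].

(** The next two lemmas compare the street and the circle car by car: all cars
    of [s] park on the street exactly when [ord_max] stays free on the circle,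
    and then the same spaces are taken. *)
Lemma all_parked_taken w s : uniq s ->
  (forall i, i \in s -> exists j, street_after w s j = Some i) ->
  circular_taken (widen_pref w) s = taken_spaces (street_after w s).
Proof.
elim/last_ind: s => [_ _|s i IHs].
  apply/setP => a; rewrite inE; apply/esym/imsetP => -[j].
  by rewrite inE /street_after /= ffunE.
rewrite rcons_uniq => /andP[s'i uniq_s] parked.
have [j0 /street_after_rcons_spot/(_ s'i) spot_i] :
    exists j, street_after w (rcons s i) j = Some i.
  by apply: parked; rewrite mem_rcons mem_head.
have street_s j : street_after w (rcons s i) j =
    if j == j0 then Some i else street_after w s j.
  by rewrite street_after_rcons /park_car spot_i ffunE.
rewrite circular_taken_rcons IHs//.
  rewrite ffunE circular_spot_linear spot_i; apply/setP => a; rewrite !inE.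
  apply/predU1P/imsetP => [[->|/imsetP[j]]|[j]].
  - by exists j0; rewrite // inE street_s eqxx.
  - by rewrite inE => t_j ->; exists j; rewrite // inE street_s; case: (j == j0).
  rewrite inE street_s; case: (eqVneq j j0) => [-> _ ->|_ t_j ->]; first by left.
  by right; rewrite mem_taken_spaces.
move=> k s_k; have [j] : exists j, street_after w (rcons s i) j = Some k.
  by apply: parked; rewrite mem_rcons inE s_k orbT.
rewrite street_s; case: eqP => [_ [eq_ik]|_ ?]; last by exists j.
by rewrite eq_ik s_k in s'i.
Qed.

Lemma max_free_all_parked w s :
  ord_max \notin circular_taken (widen_pref w) s ->
  circular_taken (widen_pref w) s = taken_spaces (street_after w s) /\
  (forall i, i \in s -> exists j, street_after w s j = Some i).
Proof.
elim/last_ind: s => [_|s i IHs].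
  split=> //; apply/setP => a; rewrite inE; apply/esym/imsetP => -[j].
  by rewrite inE /street_after /= ffunE.
rewrite circular_taken_rcons inE negb_or => /andP[spot_max].
move=> /IHs[eq_taken parked]; move: spot_max; rewrite eq_taken inE ffunE.
rewrite circular_spot_linear street_after_rcons /park_car.
have := parking_spotP (street_after w s) (w i).
case: parking_spot => [j0 [_ free_j0 _] _|_]; last by rewrite eqxx.
split=> [|k].
  apply/setP => a; rewrite !inE.
  apply/predU1P/imsetP => [[->|/imsetP[j]]|[j]].
  - by exists j0; rewrite // inE ffunE eqxx.
  - by rewrite inE => t_j ->; exists j; rewrite // inE ffunE; case: (j == j0).
  rewrite inE ffunE; case: (eqVneq j j0) => [-> _ ->|_ t_j ->]; first by left.
  by right; rewrite mem_taken_spaces.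
rewrite mem_rcons inE => /predU1P[->|/parked[j p_j]].
  by exists j0; rewrite ffunE eqxx.
by exists j; rewrite ffunE; case: eqP => // eq_j; rewrite -eq_j p_j in free_j0.
Qed.

Lemma all_cars_park_circular w :
  all_cars_park w = (ord_max \notin circular_taken (widen_pref w) (enum 'I_n)).
Proof.
apply/forallP/idP => [parked|/max_free_all_parked[_ parked] i].
  rewrite all_parked_taken ?enum_uniq ?max_notin_taken_spaces// => i _.
  by have /existsP[j /eqP] := parked i; exists j.
have [|j p_j] := parked i; first by rewrite mem_enum.
by apply/existsP; exists j; apply/eqP.
Qed.

(** A circular preference list that leaves [ord_max] free never prefers
    [ord_max], because a preferred space is always taken in the end; hence it
    comes from a list of preferences on the street. *)
Lemma card_parking_function :
  (0 < n)%N -> #|{: parking_function n}| = (n.+1 ^ n.-1)%N.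
Proof.
move=> n_gt0; rewrite card_sig -(card_leaves_free (@ord_max n) n_gt0).
have widen_inj : injective widen_pref.
  move=> v w /ffunP eq_vw; apply/ffunP => i; apply: widen_space_inj.
  by have := eq_vw i; rewrite !ffunE.
rewrite -cardsE -(card_imset _ widen_inj); apply: eq_card => v.
apply/imsetP/idP => [[w]|].
  by rewrite !inE all_cars_park_circular => ? ->.
rewrite inE => free_max.
have pref_lt i : (v i < n)%N.
  rewrite ltn_neqAle -ltnS ltn_ord andbT; apply/negP => /eqP v_i.
  have := pref_circular_taken v (mem_enum 'I_n i).
  have -> : v i = ord_max by apply/eqP; rewrite -val_eqE /=; apply/eqP.
  by move: free_max; rewrite inE => /negPf->.
have eq_v : v = widen_pref [ffun i => Ordinal (pref_lt i)].
  by apply/ffunP => i; apply: val_inj; rewrite !ffunE.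
by exists [ffun i => Ordinal (pref_lt i)]; rewrite // inE all_cars_park_circular -eq_v;
  move: free_max; rewrite inE.
Qed.

End LinearCircular.

(** * Wallis integrals *)

Section Wallis.
Variable R : realType.
Implicit Types (x y : R) (n : nat).

Lemma derive_ge0_le (f df : R -> R) (a b : R) : a <= b ->
  (forall x, a <= x <= b -> is_derive x 1 f (df x)) ->
  (forall x, a <= x <= b -> 0 <= df x) -> f a <= f b.
Proof.
move=> le_ab df_f df_ge0.
have [||c c_ab fE] := @MVT_segment R f df a b le_ab.
- by move=> x /[!in_itv]/= /andP[ax xb]; apply: df_f; rewrite !ltW.
- apply: derivable_within_continuous => x /[!in_itv]/= x_ab.
  by apply: ex_derive; exact: df_f.
by rewrite -subr_ge0 fE mulr_ge0 ?subr_ge0// df_ge0//; move: c_ab; rewrite in_itv.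
Qed.

(** This bound and the next are tuned to Stirling's formula: for [y = 1 + 1/n]
    and after multiplication by [n + 1/2] they become [1] and
    [1 + 1 / (4 n (n + 1))], whose excess over [1] telescopes.  In both cases
    the difference of the two sides vanishes at [1] and has a derivative that is
    a square times a positive factor. *)
Lemma ln_ge_frac y : 1 <= y -> 2 * (y - 1) / (y + 1) <= ln y.
Proof.
move=> y1; rewrite -subr_ge0.
pose f x := ln x - 2 * (x - 1) / (x + 1).
pose df x := (x - 1) ^+ 2 / (x * (x + 1) ^+ 2).
have -> : 0 = f 1 by rewrite /f ln1 subrr mulr0 mul0r subr0.
apply: (@derive_ge0_le f df) => // x /andP[x1 _]; last first.
  by rewrite /df divr_ge0 ?sqr_ge0// mulr_ge0 ?sqr_ge0//; lra.
have x_gt0 : 0 < x by lra.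
have x1_neq0 : x + 1 != 0 by lra.
have dln := is_derive1_ln x_gt0.
rewrite /f; apply: is_derive_eq.
rewrite /df /GRing.scale /=.
by field; rewrite x1_neq0 gt_eqF.
Qed.

Lemma ln_le_frac y : 1 <= y -> ln y <= (y - y^-1) / 2.
Proof.
move=> y1; rewrite -subr_ge0.
pose f x := (x - x^-1) / 2 - ln x.
pose df x := (1 - x^-1) ^+ 2 / 2.
have -> : 0 = f 1 by rewrite /f ln1 invr1 subrr mul0r subr0.
apply: (@derive_ge0_le f df) => // x /andP[x1 _]; last first.
  by rewrite /df divr_ge0 ?sqr_ge0.
have x_gt0 : 0 < x by lra.
have x_neq0 : x != 0 by rewrite gt_eqF.
have dln := is_derive1_ln x_gt0.
have dV : is_derive x 1 (fun z : R => z^-1) (- x ^- 2 *: 1).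
  exact: (@is_deriveV R id x 1 1).
rewrite /f; apply: is_derive_eq.
rewrite /df /GRing.scale /=.
by field.
Qed.

(** Integrating [sin ^+ n.+2] by parts gives this recursion between
    primitives. *)
Fixpoint sin_primitive (n : nat) (x : R) : R :=
  match n with
  | 0 => x
  | 1 => - cos x
  | k.+2 => (k.+1%:R * sin_primitive k x - sin x ^+ k.+1 * cos x) / k.+2%:R
  end.

Lemma is_derive_sin_primitive n x :
  is_derive x 1 (sin_primitive n) (sin x ^+ n).
Proof.
suff [] : is_derive x 1 (sin_primitive n) (sin x ^+ n) /\
          is_derive x 1 (sin_primitive n.+1) (sin x ^+ n.+1) by [].
elim: n => [|n [IHn IHn1]]; split=> //.
- by rewrite expr0; exact: is_derive_id.
- by rewrite expr1 -[X in is_derive _ _ _ X]opprK; apply: is_deriveN.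
have -> : sin_primitive n.+2 =
    n.+2%:R^-1 *: (n.+1%:R *: sin_primitive n - (@sin R) ^+ n.+1 * (@cos R)).
  by apply/funext => z; rewrite /= mulrC !fctE.
have dX := is_deriveX n.+1 (is_derive_sin x).
have dXM := is_deriveM dX (is_derive_cos x).
have dS := is_deriveZ n.+2%:R^-1 (is_deriveB (is_deriveZ n.+1%:R IHn) dXM).
apply: is_derive_eq.
rewrite !fctE /GRing.scale /=.
have -> : cos x * (n.+1%:R * sin x ^+ n * cos x) =
    n.+1%:R * sin x ^+ n * cos x ^+ 2 by ring.
rewrite cos2sin2 !exprS.
have n2_neq0 : n.+2%:R != 0 :> R by rewrite pnatr_eq0.
have -> : n.+1%:R = n.+2%:R - 1 :> R by rewrite -[n.+2%:R]natr1 addrK.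
by field.
Qed.

(** The integral of [sin ^+ n] from [0] to [pi / 2]. *)
Definition wallis (n : nat) : R := sin_primitive n (pi / 2) - sin_primitive n 0.

Lemma wallis0 : wallis 0 = pi / 2.
Proof. by rewrite /wallis /= subr0. Qed.

Lemma wallis1 : wallis 1 = 1.
Proof. by rewrite /wallis /= cos_pihalf cos0 oppr0 opprK add0r. Qed.

Lemma wallisSS n : wallis n.+2 = n.+1%:R / n.+2%:R * wallis n.
Proof.
rewrite /wallis /= cos_pihalf sin0 expr0n /= mul0r mulr0 !subr0.
by rewrite -mulrBl -mulrBr mulrAC.
Qed.

Lemma wallis_gt0 n : 0 < wallis n.
Proof.
suff [] : 0 < wallis n /\ 0 < wallis n.+1 by [].
elim: n => [|n [W0 W1]]; last by split=> //; rewrite wallisSS !mulr_gt0 ?invr_gt0.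
by rewrite wallis0 wallis1 divr_gt0 ?pi_gt0.
Qed.

Lemma wallis_nonincreasing n : wallis n.+1 <= wallis n.
Proof.
rewrite -subr_ge0; pose f := sin_primitive n - sin_primitive n.+1.
have -> : wallis n - wallis n.+1 = f (pi / 2) - f 0.
  by rewrite /f /wallis !fctE; ring.
rewrite subr_ge0.
apply: (@derive_ge0_le f (fun x => sin x ^+ n - sin x ^+ n.+1)).
- by rewrite divr_ge0 ?pi_ge0.
- by move=> x _; apply: is_deriveB; exact: is_derive_sin_primitive.
move=> x /andP[x0 xpi]; rewrite exprSr -{1}[_ ^+ n]mulr1 -mulrBr.
rewrite mulr_ge0 ?subr_ge0 ?sin_le1// exprn_ge0// sin_ge0_pi// x0 /=.
by rewrite (le_trans xpi)// ler_pdivrMr// ler_peMr ?pi_ge0// ler1n.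
Qed.

(** The factors of [wallisSS] cancel in the product of two consecutive
    integrals. *)
Lemma wallis_mul n : n.+1%:R * wallis n * wallis n.+1 = pi / 2.
Proof.
elim: n => [|n IHn]; first by rewrite wallis0 wallis1 mul1r mulr1.
rewrite wallisSS -IHn; have n2_neq0 : n.+2%:R != 0 :> R by rewrite pnatr_eq0.
by field.
Qed.

Lemma wallis_double n :
  wallis n.*2 * (2 ^+ n * n`!%:R) ^+ 2 = n.*2`!%:R * (pi / 2).
Proof.
elim: n => [|n IHn]; first by rewrite wallis0 fact0 expr0 !mulr1 expr1n mulr1 mul1r.
rewrite doubleS wallisSS !factS !natrM [2 ^+ n.+1]exprS.
have -> : n.*2.+2%:R = 2 * n.+1%:R :> R by rewrite -natrM mul2n.
have n1_neq0 : n.+1%:R != 0 :> R by rewrite pnatr_eq0.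
transitivity (2 * n.+1%:R * n.*2.+1%:R *
              (wallis n.*2 * (2 ^+ n * n`!%:R) ^+ 2)); first by field.
by rewrite IHn; ring.
Qed.

End Wallis.

(** * Stirling's formula *)

Section Stirling.
Local Open Scope classical_set_scope.
Variable R : realType.
Implicit Types (x y : R) (n : nat).
Local Notation wallis := (@wallis R).

Lemma eq_cvgn (f g : nat -> R) (l : R) :
  f =1 g -> f @ \oo --> l -> g @ \oo --> l.
Proof. by move=> /funext ->. Qed.

(** For [n > 0], the logarithm of [n! / ((n / e) ^ n * sqrt n)]. *)
Definition log_stirling (n : nat) : R :=
  ln n`!%:R + n%:R - (n%:R + 2^-1) * ln n%:R.

Lemma log_stirling_diff n : (0 < n)%N ->
  log_stirling n - log_stirling n.+1 =
  (n%:R + 2^-1) * (ln n.+1%:R - ln n%:R) - 1.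
Proof.
move=> n_gt0; rewrite /log_stirling factS natrM lnM ?posrE ?ltr0n ?fact_gt0//.
by rewrite -(natr1 n); ring.
Qed.

Lemma log_stirling_step n : (0 < n)%N ->
  0 <= log_stirling n - log_stirling n.+1 <= (n%:R^-1 - n.+1%:R^-1) / 4.
Proof.
move=> n_gt0; have n_gt0R : 0 < n%:R :> R by rewrite ltr0n.
rewrite log_stirling_diff// -ln_div ?posrE ?ltr0n//.
have ge1 : 1 <= n.+1%:R / n%:R :> R by rewrite ler_pdivlMr// mul1r ler_nat.
have half_gt0 : 0 <= n%:R + 2^-1 :> R by lra.
have := ler_wpM2l half_gt0 (ln_ge_frac ge1).
have := ler_wpM2l half_gt0 (ln_le_frac ge1).
set D := _ * ln _; rewrite -(natr1 n) /=.
have -> : (n%:R + 2^-1) * (((n%:R + 1) / n%:R - ((n%:R + 1) / n%:R)^-1) / 2)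
   = 1 + (n%:R^-1 - (n%:R + 1)^-1) / 4 :> R.
  by field; rewrite !gt_eqF//; lra.
have -> : (n%:R + 2^-1) * (2 * ((n%:R + 1) / n%:R - 1) / ((n%:R + 1) / n%:R + 1))
   = 1 :> R.
  by field; rewrite !gt_eqF//; lra.
by lra.
Qed.

(** The steps are nonnegative, and they telescope against [1 / (4 n)], which
    gives a lower bound. *)
Lemma is_cvg_log_stirling : cvgn (fun n => log_stirling n.+1).
Proof.
apply: nonincreasing_is_cvgn.
  apply/nonincreasing_seqP => n.
  by have := log_stirling_step (ltn0Sn n); lra.
exists (log_stirling 1 - 4^-1) => _ [n _ <-].
suff : log_stirling 1 - 4^-1 <= log_stirling n.+1 - n.+1%:R^-1 / 4.
  by move=> /le_trans; apply; rewrite gerBl divr_ge0// invr_ge0 ler0n.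
elim: n => [|n IHn]; first by rewrite invr1 mul1r.
have /andP[_] := log_stirling_step (ltn0Sn n); rewrite mulrBl.
by move: IHn; set a := n.+1%:R^-1 / 4; set b := n.+2%:R^-1 / 4; lra.
Qed.

(** The left-hand side of [wallis_mul] at [n.*2], with the second integral
    replaced by the first: consecutive integrals have a ratio close to [1], so
    this is close to [pi / 2]. *)
Definition scaled_wallis (n : nat) : R := n.*2.+1%:R * wallis n.*2 ^+ 2.

Lemma scaled_wallis_bounds n :
  pi / 2 <= scaled_wallis n <= pi / 2 * (n.*2.+2%:R / n.*2.+1%:R).
Proof.
rewrite /scaled_wallis -(wallis_mul _ n.*2); have W0 := wallis_gt0 R n.*2.
have W1 := wallis_nonincreasing R n.*2; have W2 := wallis_nonincreasing R n.*2.+1.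
apply/andP; split.
  by rewrite expr2 mulrA ler_wpM2l// mulr_ge0 ?ltW.
rewrite expr2 mulrA -[leRHS]mulrA ler_wpM2l//; first by rewrite mulr_ge0 ?ltW.
rewrite mulrA ler_pdivlMr ?ltr0n//.
rewrite wallisSS mulrAC ler_pdivrMr ?ltr0n// in W2.
by rewrite mulrC.
Qed.

Lemma cvg_scaled_wallis : scaled_wallis n @[n --> \oo] --> (pi / 2 : R).
Proof.
have cvg0 : n.*2.+1%:R^-1 @[n --> \oo] --> (0 : R).
  apply: (@squeeze_cvgr _ _ _ _ (fun=> 0) (fun n => n.+1%:R^-1)).
  - apply: nearW => n; rewrite invr_ge0 ler0n /= lef_pV2 ?posrE ?ltr0n// ler_nat ltnS.
    by rewrite -addnn leq_addr.
  - exact: cvg_cst.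
  - exact: cvg_harmonic.
apply: (@squeeze_cvgr _ _ _ _ (fun=> pi / 2)
          (fun n => pi / 2 * (1 + n.*2.+1%:R^-1))).
- apply: nearW => n; have := scaled_wallis_bounds n.
  have -> : n.*2.+2%:R / n.*2.+1%:R = 1 + n.*2.+1%:R^-1 :> R; last by [].
  have : n.*2.+1%:R != 0 :> R by rewrite pnatr_eq0.
  by rewrite -[n.*2.+2%:R]natr1 => ?; field.
- exact: cvg_cst.
rewrite -[X in _ --> X]mulr1; apply: cvgM; first exact: cvg_cst.
rewrite -[X in _ --> X]addr0; apply: cvgD => //; exact: cvg_cst.
Qed.

(** On the left the powers of [n] and [e] cancel and the central binomial
    coefficient remains, which [wallis_double] expresses through [wallis]. *)
Lemma log_stirling_double n : (0 < n)%N ->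
  2 * log_stirling n - log_stirling n.*2 =
  ln (pi / 2) - ln (scaled_wallis n) / 2 + ln (4 + 2 / n%:R) / 2.
Proof.
move=> n_gt0; have n_gt0R : 0 < n%:R :> R by rewrite ltr0n.
have W0 := wallis_gt0 R n.*2.
have fact_pos m : 0 < m`!%:R :> R by rewrite ltr0n fact_gt0.
have pow_pos : 0 < 2 ^+ n :> R by rewrite exprn_gt0.
have pi2_pos : 0 < pi / 2 :> R by rewrite divr_gt0 ?pi_gt0.
have lnW : ln (wallis n.*2) + 2 * (n%:R * ln 2 + ln n`!%:R) =
    ln n.*2`!%:R + ln (pi / 2).
  rewrite -[RHS]lnM ?posrE// -wallis_double [RHS]lnM ?posrE ?exprn_gt0 ?mulr_gt0//.
  rewrite lnXn ?mulr_gt0// [ln (2 ^+ n * _)]lnM ?posrE// lnXn//.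
  by rewrite !mulr_natl.
have -> : 4 + 2 / n%:R = 2 * n.*2.+1%:R / n%:R :> R.
  by rewrite -[n.*2.+1%:R]natr1 -mul2n natrM; field; exact: lt0r_neq0.
rewrite [ln (_ / n%:R)]ln_div ?posrE ?mulr_gt0 ?ltr0n//.
rewrite [ln (2 * n.*2.+1%:R)]lnM ?posrE ?ltr0n//.
rewrite /scaled_wallis [ln (_ * _ ^+ 2)]lnM ?posrE ?exprn_gt0 ?ltr0n// lnXn//.
rewrite /log_stirling -mul2n natrM [ln (2 * n%:R)]lnM ?posrE ?ltr0n// mul2n.
move: lnW; rewrite mulr2n.
set a := ln (wallis _); set b := ln (pi / 2); set c := ln n%:R.
set d := ln n.*2.+1%:R; set e := ln n.*2`!%:R; set f := ln n`!%:R => lnW.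
have -> : a = e + b - 2 * (n%:R * ln 2 + f) by rewrite -lnW addrK.
by field.
Qed.

(** The limit [l] exists, and [2 L_n - L_(2n)] tends to both [2 l - l = l] and
    [ln (pi / 2) - ln (pi / 2) / 2 + ln 4 / 2 = ln (2 pi) / 2]. *)
Lemma cvg_log_stirling : log_stirling n.+1 @[n --> \oo] --> (ln (2 * pi) / 2 : R).
Proof.
have /cvg_ex[l cvg_l] := is_cvg_log_stirling.
suff -> : ln (2 * pi) / 2 = l by [].
have cvg_sub : log_stirling n.+1.*2 @[n --> \oo] --> l.
  have dbl : (fun n => n.*2.+1) @ \oo --> \oo.
    apply/cvgnyPge => m; near=> n; rewrite (@leq_trans n)//.
      by near: n; exact: nbhs_infty_ge.
    by rewrite -addnn -addnS leq_addr.
  by apply: eq_cvgn (cvg_comp _ _ dbl cvg_l) => n; rewrite /= doubleS.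
have cvg_l2 : 2 * log_stirling n.+1 - log_stirling n.+1.*2 @[n --> \oo] --> l.
  rewrite -[X in _ --> X](_ : 2 * l - l = l); last by ring.
  by apply: cvgB => //; apply: cvgM => //; exact: cvg_cst.
have pi2_gt0 : 0 < pi / 2 :> R by rewrite divr_gt0 ?pi_gt0.
have cvg_w : ln (scaled_wallis n.+1) @[n --> \oo] --> ln (pi / 2 : R).
  apply: (@cvg_comp _ _ _ (fun n => scaled_wallis n.+1) (@ln R));
    last exact: continuous_ln.
  by have := cvg_scaled_wallis; rewrite -cvg_shiftS.
have cvg_4 : ln (4 + 2 / n.+1%:R) @[n --> \oo] --> ln (4 : R).
  apply: (@cvg_comp _ _ _ (fun n => 4 + 2 / n.+1%:R) (@ln R));
    last exact: continuous_ln.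
  change ((fun n => 4 + 2 / n.+1%:R) @ \oo --> (4 : R)).
  rewrite -[X in _ --> X]addr0; apply: cvgD; first exact: cvg_cst.
  rewrite -[X in _ --> X](mulr0 2); apply: cvgM; first exact: cvg_cst.
  exact: cvg_harmonic.
have cvg_r : 2 * log_stirling n.+1 - log_stirling n.+1.*2 @[n --> \oo] -->
    ln (pi / 2) - ln (pi / 2) / 2 + ln 4 / 2.
  apply: (@eq_cvgn (fun n => ln (pi / 2) - ln (scaled_wallis n.+1) / 2
                             + ln (4 + 2 / n.+1%:R) / 2)) => [n|].
    by rewrite log_stirling_double.
  apply: cvgD; last by apply: cvgM => //; exact: cvg_cst.
  apply: cvgB; first exact: cvg_cst.
  by apply: cvgM => //; exact: cvg_cst.
have <- := cvg_unique _ cvg_r cvg_l2.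
have -> : 2 * pi = pi / 2 * 4 :> R by field.
by rewrite lnM ?posrE//; field.
Unshelve. all: by end_near. Qed.

(** With [m = n.+1] and [D = ln (m + 1) - ln m], the last term is [(m - 1) D].
    Since [(m + 1/2) D - 1 = L_m - L_(m+1)] tends to [0], so does [D], and
    [(m - 1) D] tends to [1]. *)
Lemma cvg_log_ratio :
  log_stirling n.+1 - ln (2 * pi) / 2 + 1
    - n%:R * (ln n.+2%:R - ln n.+1%:R) @[n --> \oo] --> (0 : R).
Proof.
have cvg_step : log_stirling n.+1 - log_stirling n.+2 @[n --> \oo] --> (0 : R).
  have -> : 0 = ln (2 * pi) / 2 - ln (2 * pi) / 2 :> R by rewrite subrr.
  apply: cvgB; first exact: cvg_log_stirling.
  by have := cvg_log_stirling; rewrite -cvg_shiftS.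
have cvg_D : ln n.+2%:R - ln n.+1%:R @[n --> \oo] --> (0 : R).
  apply: (@eq_cvgn (fun n => (1 + (log_stirling n.+1 - log_stirling n.+2)) *
                             (n.+1%:R + 2^-1)^-1)) => [n|].
    rewrite log_stirling_diff//.
    by rewrite [1 + _]addrC subrK mulrC mulKf.
  rewrite -[X in _ --> X](mulr0 (1 + 0)); apply: cvgM.
    by apply: cvgD => //; exact: cvg_cst.
  apply: (@squeeze_cvgr _ _ _ _ (fun=> 0) (fun n => n.+1%:R^-1)).
  - apply: nearW => n; have n1_gt0 : 0 < n.+1%:R :> R by [].
    by rewrite invr_ge0 lef_pV2 ?posrE; lra.
  - exact: cvg_cst.
  - exact: cvg_harmonic.
apply: (@eq_cvgn (fun n => (log_stirling n.+1 - ln (2 * pi) / 2) -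
   (log_stirling n.+1 - log_stirling n.+2)
   + 3 / 2 * (ln n.+2%:R - ln n.+1%:R))) => [n|].
  rewrite [_ - log_stirling _.+2]log_stirling_diff//.
  by field.
rewrite -[X in _ --> X](_ : ln (2 * pi) / 2 - ln (2 * pi) / 2 - 0 + 3 / 2 * 0 = 0);
  last by rewrite subrr subr0 mulr0 addr0.
apply: cvgD; last by apply: cvgM => //; exact: cvg_cst.
apply: cvgB => //; apply: cvgB; last exact: cvg_cst.
exact: cvg_log_stirling.
Qed.

(** The ratio at [n.+1] is the exponential of the sequence of
    [cvg_log_ratio]. *)
Lemma max_probability_asymptotics :
  asymptotically_equivalent
    (fun n : nat => n`!%:R / n.+1%:R ^+ n.-1 : R)
    (fun n : nat => Num.sqrt (2 * pi) * n%:R `^ (3 / 2) / expR n.+1%:R).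
Proof.
rewrite /asymptotically_equivalent -cvg_shiftS.
have := cvg_comp _ _ cvg_log_ratio (@continuous_expR R 0).
rewrite expR0; apply: eq_cvgn => n.
have pi2_gt0 : 0 < 2 * pi :> R by rewrite mulr_gt0 ?pi_gt0.
have eq_fact : n.+1`!%:R = expR (ln n.+1`!%:R) :> R.
  by rewrite lnK ?posrE// ltr0n fact_gt0.
have eq_pow : n.+2%:R ^+ n = expR (n%:R * ln n.+2%:R) :> R.
  by rewrite expRM_natl lnK ?posrE.
have eq_sqrt : Num.sqrt (2 * pi) = expR (ln (2 * pi) / 2) :> R.
  by rewrite -powR12_sqrt ?ltW// /powR gt_eqF// mulrC.
rewrite /= eq_fact eq_pow eq_sqrt /powR pnatr_eq0 /= -!expRB -!expRD -!expRB.
congr expR; rewrite /log_stirling.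
by field.
Qed.

End Stirling.

(** * Maximum and minimum of the parking measure *)

Lemma PparkE (R : realType) (n : nat) (s : 'S_n) : (0 < n)%N ->
  Ppark R s = #|[set w : parking_function n | Tpark w == s]|%:R / n.+1%:R ^+ n.-1.
Proof. by move=> n_gt0; rewrite /Ppark card_parking_function// natrX. Qed.

Theorem corollary4 (R : realType) :
  [/\ forall n : nat, (0 < n)%N ->
        let M : R := n`!%:R / n.+1%:R ^+ n.-1 in
        [/\ Ppark R (1%g : 'S_n) = M,
            forall s : 'S_n, Ppark R s <= M
          & forall s : 'S_n, Ppark R s = M -> s = 1%g],
      asymptotically_equivalent
        (fun n : nat => n`!%:R / n.+1%:R ^+ n.-1 : R)
        (fun n : nat => Num.sqrt (2 * pi) * n%:R `^ (3 / 2) / expR n.+1%:R)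
    & forall n : nat, (0 < n)%N ->
        let m : R := 1 / n.+1%:R ^+ n.-1 in
        [/\ Ppark R (decreasing_perm n) = m,
            forall s : 'S_n, m <= Ppark R s
          & forall s : 'S_n, Ppark R s = m -> s = decreasing_perm n]].
Proof.
have den_neq0 n : n.+1%:R ^+ n.-1 != 0 :> R by rewrite expf_neq0// pnatr_eq0.
have den_inv_gt0 n : 0 < (n.+1%:R ^+ n.-1)^-1 :> R by rewrite invr_gt0 exprn_gt0.
split=> [n n_gt0 M||n n_gt0 m]; last 1 first.
- rewrite /m; split=> [|s|s]; rewrite PparkE//.
  + by rewrite card_outcome_decreasing.
  + by rewrite ler_pM2r// ler1n; have /andP[] := card_outcome_bounds s.
  move=> /(divIf (den_neq0 n))/eqP; rewrite -[1]/(1%:R) eqr_nat => /eqP.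
  exact: card_outcome_min.
- rewrite /M; split=> [|s|s]; rewrite PparkE//.
  + by rewrite card_outcome_id.
  + by rewrite ler_pM2r// ler_nat; have /andP[] := card_outcome_bounds s.
  move=> /(divIf (den_neq0 n))/eqP; rewrite eqr_nat => /eqP.
  exact: card_outcome_max.
exact: max_probability_asymptotics.
Qed.
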